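(* There exist quasi-Leinster ZM-groups; that is, there exists a ZM-group $G$ with $D(G)=2|G|+1$.
   Context: A ZM-group (Zassenhaus metacyclic group) is a finite group all of whose Sylow subgroups are cyclic. For a finite group $G$ let $D(G)=\sum_{N\trianglelefteq G}|N|$, the sum of the orders of all normal subgroups of $G$ (including the trivial subgroup and $G$ itself). The group $G$ is quasi-Leinster if $D(G)=2|G|+1$. Equivalently (a known fact), ZM-groups are the groups $ZM(m,n,r)=\langle a,b\mid a^m=b^n=1,\ b^{-1}ab=a^r\rangle$, of order $mn$, where $m,n,r$ are positive integers with $\gcd(m,n)=\gcd(m,r-1)=1$ and $r^n\equiv 1 \pmod m$. *)

(* Defs.v *)
From mathcomp Require Import all_boot all_fingroup all_solvable.

Set Implicit Arguments.
Unset Strict Implicit.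
Unset Printing Implicit Defensive.

Definition sum_normal_orders (gT : finGroupType) (G : {group gT}) : nat :=
  \sum_(N : {group gT} | (N <| G)%g) #|N|.

Definition quasi_Leinster (gT : finGroupType) (G : {group gT}) : Prop :=
  sum_normal_orders G = 2 * #|G| + 1.

(* Main.v *)
(** Let [K] be a normal subgroup of prime order of [G] with ['C_G(K) = K].
    A nontrivial normal subgroup of [G] that avoided [K] would centralise it,
    so it contains [K]; hence [D(G) = 1 + |K| D(G/K)].  When [G/K] is cyclic of
    order [n], [D(G/K)] is the divisor sum of [n], so that [G] is quasi-Leinster
    as soon as [n] is perfect.  For the holomorph of the cyclic group of order 7,
    [n = 6] is perfect; the holomorph has squarefree order 42, so its Sylow
    subgroups are trivial or of prime order. *)
Require Import Defs.
From mathcomp Require Import all_boot all_fingroup all_solvable.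
From mathcomp Require Import zmodp.

Set Implicit Arguments.
Unset Strict Implicit.
Unset Printing Implicit Defensive.

Local Open Scope group_scope.

(** A cyclic group has exactly one subgroup of each order dividing [#|G|], and all of them are
    normal, so the orders of normal subgroups list the divisors without repetition. *)
Lemma sum_normal_orders_cyclic (gT : finGroupType) (G : {group gT}) :
  cyclic G -> sum_normal_orders G = (\sum_(d <- divisors #|G|) d)%N.
Proof.
move=> cycG; pose s := [seq N : {group gT} <- index_enum _ | N <| G].
have -> : sum_normal_orders G = (\sum_(d <- [seq #|gval N| | N <- s]) d)%N.
  by rewrite big_map big_filter.
apply/perm_big/uniq_perm=> [||d]; rewrite ?divisors_uniq //.
- rewrite map_inj_in_uniq ?filter_uniq ?index_enum_uniq // => N M.
  rewrite !mem_filter => /andP[/normal_sub sNG _] /andP[/normal_sub sMG _] eqNM.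
  by apply/val_inj/eqP; rewrite /= (eq_subG_cyclic cycG) ?eqNM.
rewrite -dvdn_divisors ?cardG_gt0 //; apply/mapP/idP=> [[N] | dvd_d].
  by rewrite mem_filter => /andP[/normal_sub/cardSg dvdN _] ->.
have [a defG] := cyclicP cycG; rewrite defG in dvd_d.
have := cycle_sub_group dvd_d => /setP/(_ <[a ^+ (#[a] %/ d)]>%G).
rewrite !inE eqxx -defG => /andP[sNG /eqP cardN].
exists <[a ^+ (#[a] %/ d)]>%G => //.
by rewrite mem_filter mem_index_enum andbT -sub_abelian_normal ?cyclic_abelian.
Qed.

Section SelfCentralisingPrime.

Variables (gT : finGroupType) (G K : {group gT}).
Hypotheses (prK : prime #|K|) (nsKG : K <| G) (sCK : 'C_G(K) \subset K).

Lemma prime_self_centralising_sub_normal (N : {group gT}) :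
  N <| G -> N :!=: 1 -> K \subset N.
Proof.
move=> nsNG; apply: contraR => not_sKN.
have tiKN : K :&: N = 1 by apply: prime_TIg.
have cKN : N \subset 'C(K).
  (* Both subgroups are normal, so [[~: K, N]] lies in [K :&: N], which is trivial. *)
  rewrite centsC; apply/commG1P/trivgP; rewrite -tiKN subsetI.
  rewrite commg_subl commg_subr.
  have [[sNG nNG] [sKG nKG]] := (andP nsNG, andP nsKG).
  by rewrite (subset_trans sNG nKG) (subset_trans sKG nNG).
rewrite -subG1 -tiKN subsetI subxx andbT (subset_trans _ sCK) //.
by rewrite subsetI (normal_sub nsNG).
Qed.

Lemma sum_normal_orders_quotient :
  sum_normal_orders G = (1 + #|K| * sum_normal_orders (G / K))%N.
Proof.
rewrite /sum_normal_orders (bigD1 1%G) ?normal1 //= cards1; congr (_ + _)%N.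
rewrite big_distrr /=.
(* Correspondence theorem: the remaining [N] contain [K], hence are preimages of normal subgroups of
   [G / K]. *)
rewrite (reindex_onto (fun L : {group coset_of K} => coset K @*^-1 L)%G
          (fun N => N / K)%G) /= => [|N /andP[nsNG ntN]]; last first.
  apply/val_inj; rewrite /= quotientGK //.
  apply: normalS nsKG; last exact: normal_sub.
  exact: prime_self_centralising_sub_normal.
apply: eq_big => [L | L _]; last exact: card_cosetpre.
have -> : ((coset K @*^-1 L)%G / K)%G == L by apply/eqP/val_inj/cosetpreK.
rewrite andbT.
rewrite -{1}(quotientGK nsKG) cosetpre_normal andb_idr // => _.
(* No preimage is the trivial group already split off: its order is a multiple of the prime
   [#|K|]. *)
apply: contraTneq prK => /(congr1 (fun H : {group gT} => #|H|)) /=.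
rewrite card_cosetpre cards1 => /eqP.
by rewrite muln_eq1 => /andP[/eqP->].
Qed.

End SelfCentralisingPrime.

(** Since [K] centralises itself, Dedekind's modular law gives ['C_G(K) = K * 'C_H(K)]. *)
Lemma sdprod_faithful_self_centralising (gT : finGroupType) (G K H : {group gT}) :
  K ><| H = G -> abelian K -> 'C_H(K) = 1 -> 'C_G(K) \subset K.
Proof.
case/sdprodP=> _ <- _ _ cKK faithH.
by rewrite -group_modl // faithH mulg1.
Qed.

Lemma Zgroup_squarefree (gT : finGroupType) (G : {group gT}) :
  (forall p, logn p #|G| <= 1) -> Zgroup G.
Proof.
move=> sqfG; apply/forall_inP=> P /SylowP[p p_pr sylP].
have:= card_Hall sylP; rewrite p_part.
case: (logn p #|G|) (sqfG p) => [|[|]] // _ cardP.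
  by rewrite (card1_trivg cardP) cyclic1.
by rewrite prime_cyclic // cardP.
Qed.

(** The witness is the semidirect product of the cyclic group of order [p] by its full automorphism
    group, itself cyclic of order [p.-1]. *)
Lemma holomorph_prime (p : nat) : prime p ->
  exists (gT : finGroupType) (G : {group gT}),
    #|G| = (p * p.-1)%N
    /\ sum_normal_orders G = (1 + p * \sum_(d <- divisors p.-1) d)%N.
Proof.
move=> p_pr.
pose C := (Zp p)%G.
have cardC : #|C| = p by rewrite card_Zp ?prime_gt0.
have prC : prime #|C| by rewrite cardC.
have cycC := prime_cyclic prC.
have cardA : #|Aut C| = p.-1.
  by rewrite card_Aut_cyclic // cardC totient_prime.
pose to := ([Aut C])%gact.
pose K := (sdpair1 to @* C)%G; pose H := (sdpair2 to @* Aut C)%G.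
have cardK : #|K| = p by rewrite card_injm ?injm_sdpair1.
have cardH : #|H| = p.-1 by rewrite card_injm ?injm_sdpair2.
have defG : K ><| H = [set: sdprod_groupType to]%G := sdprod_sdpair to.
have [nsKG _ _ _ _] := sdprod_context defG.
have faithH : 'C_H(K) = 1.
  apply/trivgP/subsetP=> _ /setIP[/morphimP[a Aa _ ->] cKa].
  (* Centralising [K] in the product means fixing [C] pointwise, which only the identity
     automorphism does. *)
  have: a \in 'C(C | to) by rewrite astabEsd // inE Aa inE.
  move/astab_act=> fixa; suff ->: a = 1 by rewrite morph1 group1.
  by apply: (eq_Aut Aa (group1 _)) => x Cx; rewrite perm1 -[RHS](fixa x Cx).
exists (sdprod_groupType to), [set: sdprod_groupType to]%G; split.
  by rewrite -(sdprod_card defG) cardK cardH.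
have sCK : 'C_([set: sdprod_groupType to])(K) \subset K.
  apply: sdprod_faithful_self_centralising defG _ faithH.
  by rewrite cyclic_abelian ?prime_cyclic ?cardK.
rewrite (sum_normal_orders_quotient _ nsKG sCK) ?cardK //.
have isoH := sdprod_isog defG.
rewrite sum_normal_orders_cyclic; last first.
  by rewrite -(isog_cyclic isoH) morphim_cyclic ?Aut_prime_cyclic.
by rewrite -(card_isog isoH) cardH.
Qed.

Theorem proposition3p3 :
  exists (gT : finGroupType) (G : {group gT}), Zgroup G /\ quasi_Leinster G.
Proof.
have [gT [G [cardG sumG]]] := @holomorph_prime 7 isT.
exists gT, G; split; last first.
  (* Here [1 + 7 * 12 = 85 = 2 * 42 + 1]; unlocking the sum lets it compute. *)
  by rewrite /quasi_Leinster sumG cardG unlock.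
apply: Zgroup_squarefree => p; rewrite cardG -[(7 * _)%N]/(2 * (3 * 7))%N.
rewrite !lognM // !logn_prime //.
by case: p => [|[|[|[|[|[|[|[|p]]]]]]]].
Qed.
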